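(* Every complex orthogonal permutative matrix $A$ of order $4$ is a linear combination of (at most four) permutation matrices, in the following way: there exist $\overline{P}\in 1\oplus\mathcal{P}_3$ and $x,y,z,w\in\mathbb{C}$ such that (a) when $A\in\mathcal{X}$: $\overline{P}^TA=xP_{(34)}+yP_{(12)}+zP_{(13)(24)}+wP_{(14)(23)}$, where $x+y+z+w=\pm1$, $xy+zw=0$, $x^2+y^2+z^2+w^2=1$; (b) when $A\in\mathcal{Y}$: $\overline{P}^TA=xP_{(24)}+yP_{(12)(34)}+zP_{(13)}+wP_{(14)(23)}$, where $x+y+z+w=\pm1$, $xz+yw=0$, $x^2+y^2+z^2+w^2=1$; (c) when $A\in\mathcal{Z}$: $\overline{P}^TA=xP_{(23)}+yP_{(12)(34)}+zP_{(13)(24)}+wP_{(14)}$, where $x+y+z+w=\pm1$, $xw+yz=0$, $x^2+y^2+z^2+w^2=1$; and every such $A$ falls under at least one of the cases (a), (b), (c).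
   Context: $\mathcal{P}_n$ is the group of $n\times n$ permutation matrices; for a permutation $\sigma$, $P_\sigma$ has $(i,j)$ entry $1$ if $\sigma(i)=j$ and $0$ otherwise. $1\oplus\mathcal{P}_3=\left\{\begin{bmatrix}1&\mathbf{0}^T\\ \mathbf{0}&P\end{bmatrix}: P\in\mathcal{P}_3\right\}$. A matrix is permutative if each of its rows is a permutation of any other row. An orthogonal permutative matrix is a permutative complex matrix $A$ with $A^TA=I$. For complex $t,x,z$ and a sign $\pm$: $$A_t=\begin{bmatrix}t&-t\\-t&t\end{bmatrix},\quad B^{\pm}_t=\begin{bmatrix}t&\pm1-t\\ \pm1-t&t\end{bmatrix},\quad F=\begin{bmatrix}0&1\\1&0\end{bmatrix},$$ $$M^{\pm}_{x,z}=\begin{bmatrix}A_x&B^{\pm}_z\\ B^{\pm}_z&-A_x\end{bmatrix},\quad N^{\pm}_{x,z}=\begin{bmatrix}B^{\pm}_x&A_z\\ A_z&FB^{\pm}_x\end{bmatrix}.$$ $\mathcal{X}$ is the set of all matrices $\overline{P}M^{\pm}_{x,z}$ and $\overline{P}N^{\pm}_{z,x}$ with $\overline{P}\in1\oplus\mathcal{P}_3$, $x,z\in\mathbb{C}$, $x^2+z^2\mp z=0$ (upper signs together, lower signs together). $\mathcal{Y}$ is the set of all $\overline{P}P_{(23)}M^{\pm}_{x,z}P_{(23)}$ and $\overline{P}P_{(23)}N^{\pm}_{z,x}P_{(23)}$, and $\mathcal{Z}$ the set of all $\overline{P}P_{(24)}M^{\pm}_{x,z}P_{(24)}$ and $\overline{P}P_{(24)}N^{\pm}_{z,x}P_{(24)}$,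 with the same ranges of $\overline{P},x,z$. *)

(* Defs.v *)
From mathcomp Require Import all_boot all_order all_fingroup all_algebra.
From mathcomp Require Import reals complex.

Set Implicit Arguments.
Unset Strict Implicit.
Unset Printing Implicit Defensive.

Import GRing.Theory.
Local Open Scope ring_scope.

(* The indices 1, 2, 3, 4 of the usual notation for rows and columns. *)
Definition i1 : 'I_4 := @Ordinal 4 0 isT.
Definition i2 : 'I_4 := @Ordinal 4 1 isT.
Definition i3 : 'I_4 := @Ordinal 4 2 isT.
Definition i4 : 'I_4 := @Ordinal 4 3 isT.

Section Definitions.
Variable K : fieldType.

Definition permutative m n (A : 'M[K]_(m, n)) : Prop :=
  forall i k : 'I_m, exists s : 'S_n, row i A = col_perm s (row k A).

Definition orthogonal_permutative n (A : 'M[K]_n) : Prop :=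
  permutative A /\ A^T *m A = 1%:M.

(* perm_mx s has (i, j) entry 1 if s i = j and 0 otherwise. *)
Definition P12 : 'M[K]_4 := perm_mx (tperm i1 i2).
Definition P13 : 'M[K]_4 := perm_mx (tperm i1 i3).
Definition P14 : 'M[K]_4 := perm_mx (tperm i1 i4).
Definition P23 : 'M[K]_4 := perm_mx (tperm i2 i3).
Definition P24 : 'M[K]_4 := perm_mx (tperm i2 i4).
Definition P34 : 'M[K]_4 := perm_mx (tperm i3 i4).
Definition P12_34 : 'M[K]_4 := perm_mx (tperm i1 i2 * tperm i3 i4)%g.
Definition P13_24 : 'M[K]_4 := perm_mx (tperm i1 i3 * tperm i2 i4)%g.
Definition P14_23 : 'M[K]_4 := perm_mx (tperm i1 i4 * tperm i2 i3)%g.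

(* Membership in 1 (+) P_3; lift0_mx Q is the block matrix diag(1, Q). *)
Definition one_oplus_P3 (P : 'M[K]_4) : Prop :=
  exists s : 'S_3, P = lift0_mx (perm_mx s).

(* In the definitions below the sign +/- is a scalar e with e = 1 or e = -1. *)
Definition is_sign (e : K) : Prop := e = 1 \/ e = -1.

Definition Amx (t : K) : 'M[K]_2 :=
  \matrix_(i, j) (if i == j then t else - t).

Definition Bmx (e t : K) : 'M[K]_2 :=
  \matrix_(i, j) (if i == j then t else e - t).

Definition Fmx : 'M[K]_2 :=
  \matrix_(i, j) (if i == j then 0 else 1).

Definition Mmx (e x z : K) : 'M[K]_4 :=
  block_mx (Amx x) (Bmx e z) (Bmx e z) (- Amx x).

Definition Nmx (e x z : K) : 'M[K]_4 :=
  block_mx (Bmx e x) (Amx z) (Amx z) (Fmx *m Bmx e x).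

(* The matrices Pbar Q M_{x,z} Q and Pbar Q N_{z,x} Q; note the swapped
   parameters of N. *)
Definition class_conj (Q A : 'M[K]_4) : Prop :=
  exists (Pbar : 'M[K]_4) (e x z : K),
    [/\ one_oplus_P3 Pbar, is_sign e, x ^+ 2 + z ^+ 2 - e * z = 0 &
        A = Pbar *m (Q *m Mmx e x z *m Q)
        \/ A = Pbar *m (Q *m Nmx e z x *m Q)].

Definition classX (A : 'M[K]_4) : Prop :=
  exists (Pbar : 'M[K]_4) (e x z : K),
    [/\ one_oplus_P3 Pbar, is_sign e, x ^+ 2 + z ^+ 2 - e * z = 0 &
        A = Pbar *m Mmx e x z \/ A = Pbar *m Nmx e z x].

Definition classY (A : 'M[K]_4) : Prop := class_conj P23 A.

Definition classZ (A : 'M[K]_4) : Prop := class_conj P24 A.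

End Definitions.

(* Main.v *)
Require Import Defs.
From mathcomp Require Import all_boot all_order all_fingroup all_algebra.
From mathcomp Require Import reals complex.
From mathcomp Require Import ring.

Set Implicit Arguments.
Unset Strict Implicit.
Unset Printing Implicit Defensive.

Import GRing.Theory.
Local Open Scope ring_scope.
Local Open Scope complex_scope.

(** Row sums of an orthogonal permutative matrix are all equal to some [e] with
    [e^2 = 1]; hence the entries [a_j] of the first row satisfy [sum a_j = e],
    [sum a_j^2 = 1] and [sum_(i < j) a_i a_j = 0].  Two rows differ by a
    permutation [r] of the labels [j], and their orthogonality reads
    [sum_j a_j a_(r j) = 0].  Modulo the previous relations this says:
    - [(a_0 + a_k) (a_i + a_j) = 0], if [r] is a double transposition or a
      4-cycle generating a cyclic group whose involution is (0 k)(i j);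
    - [a_f = 0] or [a_f = e / 2], if [r] is a 3-cycle fixing [f];
    - [(a_p - a_q)^2 = 1], if [r] is the transposition (p q).
    Comparing the parities of the four rows shows that the first alternative
    holds for some [k], unless the first row is degenerate, i.e. a
    rearrangement of [(e, 0, 0, 0)] or [(-e/2, e/2, e/2, e/2)].  If it is not
    degenerate, the relations left over force the four rows to be the orbit of
    the cyclic group attached to [k], and the three values of [k] give the
    classes X, Y, Z.  If it is degenerate, only the position of the exceptional
    entry in each row matters, and the labels can be chosen so that the rows
    form such an orbit as well. *)

(** * Permutations of four labels *)

(** Permutations of labels are coded as lists, so that claims about all triples of them can be
    decided by [vm_compute]. *)
Definition perms4 : seq (seq nat) := permutations (iota 0 4).

(** This is [q] after the inverse of [p]: reindexing along [p] turns the inner product of the rows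
    labelled by [p] and [q] into [dot (quot p q)]. *)
Definition quot (p q : seq nat) : seq nat :=
  [seq nth 0 q (index i p) | i <- iota 0 4]%N.

(** One quotient for each pair of rows; the first row has the identity labelling, so its quotients
    are [p2], [p3], [p4]. *)
Definition quots (p2 p3 p4 : seq nat) : seq (seq nat) :=
  [:: p2; p3; p4; quot p2 p3; quot p2 p4; quot p3 p4].

Definition fixed (r : seq nat) : seq nat :=
  [seq j <- iota 0 4 | nth 0 r j == j]%N.

Definition moved (r : seq nat) : seq nat :=
  [seq j <- iota 0 4 | nth 0 r j != j]%N.

(* For a double transposition or a 4-cycle [r], the label paired with [0] by
   [r], respectively by [r^2]. *)
Definition partner (r : seq nat) : nat :=
  (let k := nth 0 r 0 in let l := nth 0 r k in if l == 0 then k else l)%N.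

Definition is_pair (k : nat) (s : seq nat) : bool :=
  match k with
  | 1%N => s \in [:: [:: 0; 1]; [:: 2; 3]]%N
  | 2%N => s \in [:: [:: 0; 2]; [:: 1; 3]]%N
  | _ => s \in [:: [:: 0; 3]; [:: 1; 2]]%N
  end.

(* The nontrivial elements of the cyclic group of order 4 whose involution is
   the double transposition pairing [0] with [k]. *)
Definition cyc4 (k : nat) : seq (seq nat) :=
  match k with
  | 1%N => [:: [:: 1; 0; 3; 2]; [:: 2; 3; 1; 0]; [:: 3; 2; 0; 1]]%N
  | 2%N => [:: [:: 1; 2; 3; 0]; [:: 2; 3; 0; 1]; [:: 3; 0; 1; 2]]%N
  | _ => [:: [:: 1; 3; 0; 2]; [:: 2; 0; 3; 1]; [:: 3; 2; 1; 0]]%N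
  end.

(** A permutation of four labels with exactly one fixed label is a 3-cycle. *)
Definition fixed_by_3cycle (rs : seq (seq nat)) : seq nat :=
  [seq f <- iota 0 4 | [:: f] \in map fixed rs].

(** The quotients that orthogonality still allows when the row is not degenerate and [pairprod k]
    vanishes. A transposition must then join the two pairs of [k]. *)
Definition compatible (k : nat) (r : seq nat) : bool :=
  (nilp (fixed r) && (partner r == k))
  || ((size (moved r) == 2)%N && ~~ is_pair k (moved r)).

Definition forall_triples (P : seq nat -> seq nat -> seq nat -> bool) : bool :=
  all (fun p2 => all (fun p3 => all (P p2 p3) perms4) perms4) perms4.

Lemma forall_triplesP P p2 p3 p4 : forall_triples P ->
  p2 \in perms4 -> p3 \in perms4 -> p4 \in perms4 -> P p2 p3 p4.
Proof. by move=> /allP H /H /allP H2 /H2 /allP H3 /H3. Qed.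

(** Rows of equal parity have an even quotient, hence a 3-cycle once the identity and the
    derangements are excluded; the last two cases record which labels such 3-cycles can fix. *)
Lemma triple_alternative p2 p3 p4 :
  p2 \in perms4 -> p3 \in perms4 -> p4 \in perms4 ->
  let rs := quots p2 p3 p4 in
  [|| has (fun r => nilp (moved r)) rs,
      has (fun r => nilp (fixed r)) rs,
      has (fun f => all (fun p => nth 0 p f == f)%N [:: p2; p3; p4])
        (fixed_by_3cycle rs)
    | (2 < size (fixed_by_3cycle rs))%N].
Proof.
move=> h2 h3 h4; apply: (forall_triplesP (P := fun p2 p3 p4 =>
  let rs := quots p2 p3 p4 in _)) h2 h3 h4.
by vm_compute.
Qed.

(** Behind the enumeration is a parity argument: the only even compatible quotient is the double
    transposition of [k], so two rows are even and two odd, each pair differing by it. A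
    transposition across the pairs of [k], times that involution, is a 4-cycle with another partner,
    so the odd rows are 4-cycles. *)
Lemma compatible_triple k p2 p3 p4 : k \in [:: 1; 2; 3]%N ->
  p2 \in perms4 -> p3 \in perms4 -> p4 \in perms4 ->
  all (compatible k) (quots p2 p3 p4) -> perm_eq [:: p2; p3; p4] (cyc4 k).
Proof.
have H : all (fun k => forall_triples (fun p2 p3 p4 =>
    all (compatible k) (quots p2 p3 p4) ==> perm_eq [:: p2; p3; p4] (cyc4 k)))
  [:: 1; 2; 3]%N by vm_compute.
move=> /(allP H) {}H h2 h3 h4.
exact: implyP (forall_triplesP H h2 h3 h4).
Qed.

(* A cyclic group of order 4 is simply transitive on the labels. *)
Lemma uniq_index_cyc4 k p2 p3 p4 : k \in iota 0 4 ->
  p2 \in perms4 -> p3 \in perms4 -> p4 \in perms4 ->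
  uniq [seq index k p | p <- [:: iota 0 4; p2; p3; p4]] ->
  exists2 c, perm_eq c (cyc4 1) &
    [seq index k p | p <- [:: p2; p3; p4]] = [seq index k p | p <- c].
Proof.
have H : all (fun k => forall_triples (fun p2 p3 p4 =>
    uniq [seq index k p | p <- [:: iota 0 4; p2; p3; p4]] ==>
    has (fun c => [seq index k p | p <- [:: p2; p3; p4]]
                  == [seq index k p | p <- c]) (permutations (cyc4 1))))
  (iota 0 4) by vm_compute.
move=> /(allP H) {}H h2 h3 h4.
move/(implyP (forall_triplesP H h2 h3 h4))/hasP=> [c].
by rewrite mem_permutations => hc /eqP hE; exists c.
Qed.

Lemma quots_perms4 p2 p3 p4 :
  p2 \in perms4 -> p3 \in perms4 -> p4 \in perms4 ->
  {subset quots p2 p3 p4 <= perms4}.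
Proof.
have H : forall_triples (fun p2 p3 p4 =>
  all (mem perms4) (quots p2 p3 p4)) by vm_compute.
by move=> h2 h3 h4; exact: allP (forall_triplesP H h2 h3 h4).
Qed.

Lemma size_fixed_moved r : (size (fixed r) + size (moved r) = 4)%N.
Proof. by rewrite !size_filter count_predC size_iota. Qed.

Lemma quot_iota q : q \in perms4 -> quot (iota 0 4) q = q.
Proof.
have H : all (fun q => quot (iota 0 4) q == q) perms4 by vm_compute.
by move/(allP H)/eqP.
Qed.

Lemma quot_self q : q \in perms4 -> quot q q = iota 0 4.
Proof.
have H : all (fun q => quot q q == iota 0 4) perms4 by vm_compute.
by move/(allP H)/eqP.
Qed.

(** * Values along a row *)

Section RowValues.
Variables (K : fieldType) (e : K) (a : nat -> K).

Definition dot (r : seq nat) : K := \sum_(j <- iota 0 4) a j * a (nth 0 r j)%N.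

Definition row_values : Prop :=
  [/\ e ^+ 2 = 1, a 0 + a 1 + a 2 + a 3 = e
    & a 0 ^+ 2 + a 1 ^+ 2 + a 2 ^+ 2 + a 3 ^+ 2 = 1].

Definition pairprod (k : nat) : K :=
  match k with
  | 1%N => (a 0 + a 1) * (a 2 + a 3)
  | 2%N => (a 0 + a 2) * (a 1 + a 3)
  | _ => (a 0 + a 3) * (a 1 + a 2)
  end.

Hypothesis two_neq0 : (2%:R : K) != 0.
Hypothesis ha : row_values.

Lemma sign_neq0 : e != 0.
Proof. by case: ha => h _ _; rewrite -sqrf_eq0 h oner_neq0. Qed.

(** Twice this sum is the square of the row sum minus the sum of squares, that is [e ^+ 2 - 1]. *)
Lemma esym2_eq0 : a 0 * a 1 + a 0 * a 2 + a 0 * a 3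
  + a 1 * a 2 + a 1 * a 3 + a 2 * a 3 = 0 :> K.
Proof.
case: ha => he hs hq; apply: (mulfI two_neq0); rewrite mulr0.
by rewrite -(subrr 1) -[X in _ = X - _]he -hs -[X in _ = _ - X]hq; ring.
Qed.

Definition dot_spec (r : seq nat) : Prop :=
  [\/ [/\ nilp (fixed r), partner r \in [:: 1; 2; 3]%N
        & pairprod (partner r) = 0],
      exists2 f, fixed r = [:: f] & a f * (2 * a f - e) = 0
    | exists p q, moved r = [:: p; q] /\ (a p - a q) ^+ 2 = 1].

(** Let [E2] be the vanishing symmetric function and [D] the inner product. For a 4-cycle [D] is the
    wanted product; for a double transposition [2 * E2 - D] is twice that product; for a 3-cycle
    fixing [f], [D - E2 = a f * (2 * a f - e)]; for a transposition [1 - D] is the squared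
    difference. The identity gives [D = 1]. *)
Lemma dot_eq0 r : r \in perms4 -> dot r = 0 -> dot_spec r.
Proof.
have h2 := esym2_eq0; case: ha => he hs hq.
have -> : perms4 = ltac:(let s := eval vm_compute in perms4 in exact s).
  by vm_compute.
rewrite !inE /dot !big_cons big_nil addr0.
set E2 := (X in X = 0) in h2.
do ![case/orP] => /eqP-> /=; set D := (X in X = 0) => hD.
all: first
  [ constructor 1; split=> //; rewrite /partner /=;
    first [ by rewrite -hD /D; ring
          | apply: (mulfI two_neq0); transitivity (2 * E2 - D);
            [by rewrite /E2 /D; ring | by rewrite h2 hD; ring] ]
  | constructor 2; eexists; first reflexivity;
    transitivity (D - E2); [by rewrite -hs /E2 /D; ring | by rewrite hD h2 subr0]
  | constructor 3; do 2!eexists; split; first reflexivity;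
    transitivity (1 - D); [by rewrite -hq /D; ring | by rewrite hD subr0]
  | case/eqP: (oner_neq0 K); rewrite -hq -hD /D; ring ].
Qed.

(** Under [row_values], [x = 0] forces [a k = e], and [a k = - x] forces [x = e / 2]: these are the
    two degenerate shapes. *)
Definition degenerate : Prop := exists k x,
  [/\ k \in iota 0 4, {in iota 0 4, forall j, j != k -> a j = x}
    & x * (a k + x) = 0].

Lemma degenerate_intro i j k l : perm_eq [:: i; j; k; l] (iota 0 4) ->
  a j = a k -> a k = a l -> a l * (a i + a l) = 0 -> degenerate.
Proof.
move=> /perm_mem hp hjk hkl h; exists i, (a l); split=> //.
  by rewrite -hp inE eqxx.
move=> m; rewrite -hp !inE => /or4P[]/eqP-> //; last by rewrite hjk.
by rewrite eqxx.
Qed.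

(** With the exceptional label [l], one factor is [a l + x] and the other is [x + x]. *)
Lemma degenerate_pairprod k : degenerate -> pairprod k = 0.
Proof.
case=> l [x [hl hx hp]].
move: hl hx hp; rewrite !inE => /or4P[] /eqP-> hx hp.
all: have := (hx 0%N isT, hx 1%N isT, hx 2%N isT, hx 3%N isT) => -[[[h0 h1] h2] h3].
all: rewrite /pairprod ?(h0 isT) ?(h1 isT) ?(h2 isT) ?(h3 isT).
all: by case: k => [|[|[|k]]]; rewrite -[RHS](mulr0 2) -hp; ring.
Qed.

(** Each of [q], [r], [s] is [0] or [t = e / 2]. If exactly one or two of them equal [t], the second
    symmetric function is [t * t], which is nonzero. *)
Lemma three_half_or_zero (p q r s : K) :
  p + q + r + s = e ->
  p * q + p * r + p * s + q * r + q * s + r * s = 0 ->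
  q * (2 * q - e) = 0 -> r * (2 * r - e) = 0 -> s * (2 * s - e) = 0 ->
  [/\ q = r, r = s & s * (p + s) = 0].
Proof.
have e0 := sign_neq0; pose t := e / 2.
have et : e = 2 * t by rewrite /t; field.
have t0 : t * t != 0 by rewrite mulf_neq0 // mulf_neq0 // invr_eq0.
have P u : u * (2 * u - e) = 0 -> u = 0 \/ u = t.
  move/eqP; rewrite et -mulrBr !mulf_eq0 (negPf two_neq0) subr_eq0 /=.
  by case/orP=> /eqP; [left|right].
move=> hs hE /P hq /P hr /P hs'.
have {hs}hp : p = 2 * t - q - r - s by rewrite -et -hs; ring.
move: hE; rewrite {p}hp => hE.
by case: hq hr hs' hE => -> [] -> [] -> hE; first [split=> //; ring
  | case/eqP: t0; rewrite -hE; ring].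
Qed.

(** This is the constraint [x ^+ 2 + z ^+ 2 - e * z = 0] of the classes, with [x = p], [z = r] and
    [s = e - z]. *)
Lemma pair_sqr (p q r s : K) :
  p + q = 0 -> r + s = e -> p ^+ 2 + q ^+ 2 + r ^+ 2 + s ^+ 2 = 1 ->
  p ^+ 2 = r * s.
Proof.
case: ha => he _ _ /eqP; rewrite addr_eq0 => /eqP-> {p} hs hq.
apply: (mulfI two_neq0).
transitivity ((- q) ^+ 2 + q ^+ 2 + r ^+ 2 + s ^+ 2 - r ^+ 2 - s ^+ 2).
  by ring.
by rewrite hq -[X in X - _ - _]he -hs; ring.
Qed.

(** These inequalities exclude, in order, 3-cycles, the two pairings other than [p q | r s], and
    transpositions inside a pair. *)
Definition generic4 (p q r s : K) : Prop :=
  [/\ [/\ p * (2 * p - e) != 0, q * (2 * q - e) != 0, r * (2 * r - e) != 0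
        & s * (2 * s - e) != 0],
      (p + r) * (q + s) != 0, (p + s) * (q + r) != 0,
      (p - q) ^+ 2 != 1 & (r - s) ^+ 2 != 1].

(** After eliminating [p] and [s], only [q ^+ 2 = r * s] remains. Degeneracy occurs when [q = 0] or
    [r = s]; the four cases name the position of the exceptional entry. *)
Lemma pair_generic4 (p q r s : K) :
  p + q = 0 -> r + s = e -> p ^+ 2 + q ^+ 2 + r ^+ 2 + s ^+ 2 = 1 ->
  [\/ [/\ q = r, r = s & s * (p + s) = 0], [/\ p = r, r = s & s * (q + s) = 0],
      [/\ p = q, q = s & s * (r + s) = 0] | [/\ p = q, q = r & r * (s + r) = 0]]
  \/ generic4 p q r s.
Proof.
move=> hp hs hq; have := pair_sqr hp hs hq.
move/eqP: hp hq; rewrite addr_eq0 => /eqP-> {p} hq; rewrite sqrrN => hpr.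
case: ha => he _ _; have {hs}hs : s = e - r by rewrite -hs; ring.
have [q0|q0] := eqVneq q 0.
  left; move/eqP: hpr; rewrite q0 expr2 mul0r eq_sym mulf_eq0 oppr0.
  case/orP=> /eqP h0.
    by constructor 4; rewrite h0 mul0r.
  by constructor 3; rewrite h0 mul0r.
have : r * s != 0 by rewrite -hpr expf_neq0.
rewrite mulf_eq0 negb_or => /andP[r0 s0].
have [rs|rs] := eqVneq r s.
  left; move/eqP: hpr; rewrite rs -expr2 eqf_sqr => /orP[]/eqP->.
    by constructor 1; split=> //; ring.
  by constructor 2; split=> //; ring.
right.
have rs0 : r - s != 0 by rewrite subr_eq0.
(* Here and below [u] stands for [q] or [- q], so that [p] is covered too. Since
   [(r - s) ^+ 2 = e ^+ 2 - 4 * u ^+ 2], the value [2 * u = e] would force [r = s]. *)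
have hpe u : u ^+ 2 = q ^+ 2 -> 2 * u - e != 0.
  move=> hu; apply/eqP=> h; case/eqP: (mulf_neq0 rs0 rs0).
  transitivity ((r + s) ^+ 2 - 4 * (r * s)); first by ring.
  rewrite -hpr -hu; transitivity (- (2 * u - e) * (2 * u + e)).
    by rewrite hs; ring.
  by rewrite h; ring.
have hqr u : u ^+ 2 = q ^+ 2 -> u + r != 0.
  move=> hu; apply/eqP=> h; case/eqP: (mulf_neq0 r0 rs0).
  transitivity ((u + r) * (r - u) + (u ^+ 2 - r * s)); first by ring.
  by rewrite h hu hpr; ring.
have hqs u : u ^+ 2 = q ^+ 2 -> u + s != 0.
  move=> hu; apply/eqP=> h; case/eqP: (mulf_neq0 s0 rs0).
  transitivity ((u + s) * (u - s) - (u ^+ 2 - r * s)); first by ring.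
  by rewrite h hu hpr; ring.
have hN : (- q) ^+ 2 = q ^+ 2 by rewrite sqrrN.
split.
- split; apply: mulf_neq0; rewrite ?oppr_eq0 //; first exact: hpe.
  + exact: hpe.
  + by rewrite (_ : _ - _ = r - s) // hs; ring.
  + by rewrite (_ : _ - _ = - (r - s)) ?oppr_eq0 // hs; ring.
- by rewrite mulf_neq0 ?hqr ?hqs.
- by rewrite mulf_neq0 ?hqr ?hqs.
- apply: contra_neq (mulf_neq0 (hpe q erefl) (hpe _ hN)) => h.
  transitivity (e ^+ 2 - (- q - q) ^+ 2); first by ring.
  by rewrite h he subrr.
- apply: contra_neq (mulf_neq0 r0 s0) => h.
  apply: (mulfI two_neq0); apply: (mulfI two_neq0).
  transitivity (e ^+ 2 - (r - s) ^+ 2); first by rewrite hs; ring.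
  by rewrite h he subrr !mulr0.
Qed.

Lemma degenerate_or_generic k : k \in [:: 1; 2; 3]%N -> pairprod k = 0 ->
  degenerate \/
  [/\ {in iota 0 4, forall f, a f * (2 * a f - e) != 0},
      {in [:: 1; 2; 3]%N, forall l, l != k -> pairprod l != 0}
    & forall p q, is_pair k [:: p; q] -> (a p - a q) ^+ 2 != 1].
Proof.
case: ha => he hs hq.
have H i j l m : perm_eq [:: i; j; l; m] (iota 0 4) -> a i + a j = 0 ->
    degenerate \/ generic4 (a i) (a j) (a l) (a m).
  move=> hp hij.
  have hsum (F : nat -> K) : F i + F j + F l + F m = F 0 + F 1 + F 2 + F 3.
    have : \sum_(x <- [:: i; j; l; m]) F x = \sum_(x <- iota 0 4) F x.
      exact: perm_big.
    by rewrite !big_cons !big_nil !addr0 !addrA.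
  have hlm : a l + a m = e by rewrite -hs -hsum hij add0r.
  have := pair_generic4 hij hlm; rewrite (hsum (fun i => a i ^+ 2)).
  case/(_ hq) => [h|h]; [left; case: h => -[h1 h2 h3] | by right].
  - exact: (@degenerate_intro i j l m).
  - apply: (@degenerate_intro j i l m) => //.
    by rewrite (perm_catCA [:: j] [:: i]).
  - apply: (@degenerate_intro l i j m) => //.
    by rewrite (perm_catCA [:: l] [:: i; j]).
  - apply: (@degenerate_intro m i j l) => //.
    by rewrite (perm_catCA [:: m] [:: i; j; l]) cats0.
(* The inequalities of [generic4] survive the exchange of the two pairs, so either factor may be the
   one that vanishes. *)
have G i j l m : perm_eq [:: i; j; l; m] (iota 0 4) ->
    (a i + a j) * (a l + a m) = 0 ->
    degenerate \/ generic4 (a i) (a j) (a l) (a m).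
  move=> hp /eqP; rewrite mulf_eq0 => /orP[]/eqP h; first exact: H hp h.
  have hp' : perm_eq [:: l; m; i; j] (iota 0 4).
    by rewrite (perm_catC [:: l; m]).
  case: (H _ _ _ _ hp' h) => [|[[h1 h2 h3 h4] h5 h6 h7 h8]]; first by left.
  right; split=> //; first by rewrite (addrC (a i)) (addrC (a j)).
  by rewrite (addrC (a i)) (addrC (a j)) mulrC.
rewrite !inE => /or3P[] /eqP->.
- case/(G 0 1 2 3 isT)%N => [|[[h1 h2 h3 h4] h5 h6 h7 h8]]; [by left | right; split].
  + by move=> f; rewrite !inE => /or4P[]/eqP->.
  + by move=> l; rewrite !inE => /or3P[]/eqP->;
      rewrite /pairprod // ?(addrC (a 2)) ?(addrC (a 1)).
  + by move=> p q; rewrite /is_pair !inE => /orP[] /eqP[-> ->].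
- case/(G 0 2 1 3 isT)%N => [|[[h1 h2 h3 h4] h5 h6 h7 h8]]; [by left | right; split].
  + by move=> f; rewrite !inE => /or4P[]/eqP->.
  + by move=> l; rewrite !inE => /or3P[]/eqP->;
      rewrite /pairprod // ?(addrC (a 2)) ?(addrC (a 1)).
  + by move=> p q; rewrite /is_pair !inE => /orP[] /eqP[-> ->].
- case/(G 0 3 1 2 isT)%N => [|[[h1 h2 h3 h4] h5 h6 h7 h8]]; [by left | right; split].
  + by move=> f; rewrite !inE => /or4P[]/eqP->.
  + by move=> l; rewrite !inE => /or3P[]/eqP->;
      rewrite /pairprod // ?(addrC (a 2)) ?(addrC (a 1)).
  + by move=> p q; rewrite /is_pair !inE => /orP[] /eqP[-> ->].
Qed.

Lemma generic_compatible k r : k \in [:: 1; 2; 3]%N ->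
    {in iota 0 4, forall f, a f * (2 * a f - e) != 0} ->
    {in [:: 1; 2; 3]%N, forall l, l != k -> pairprod l != 0} ->
    (forall p q, is_pair k [:: p; q] -> (a p - a q) ^+ 2 != 1) ->
  r \in perms4 -> dot r = 0 -> compatible k r.
Proof.
move=> hk h3 hp h2 hr /(dot_eq0 hr)[[f0 hl h]|[f hf h]|[p [q [hm h]]]].
- rewrite /compatible f0 /=; apply/orP; left; apply: contra_eqT h => hlk.
  exact: hp.
- have : f \in fixed r by rewrite hf mem_head.
  by rewrite mem_filter => /andP[_ /h3]; rewrite h eqxx.
- rewrite /compatible hm /=; apply/orP; right; apply: contra_eqN h; exact: h2.
Qed.

(** * Combining the orthogonality relations of all six pairs of rows *)

Section Triple.
Variables p2 p3 p4 : seq nat.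
Hypotheses (hp2 : p2 \in perms4) (hp3 : p3 \in perms4) (hp4 : p4 \in perms4).
Hypothesis hdot : {in quots p2 p3 p4, forall r, dot r = 0}.
(** A label fixed by all rows gives a constant column, and columns also sum to [e]. *)
Hypothesis hcol :
  forall f, all (fun p => nth 0 p f == f)%N [:: p2; p3; p4] -> 4 * a f = e.

Lemma fixed_by_3cycle_eq0 f :
  f \in fixed_by_3cycle (quots p2 p3 p4) -> a f * (2 * a f - e) = 0.
Proof.
rewrite mem_filter => /andP[/mapP[r hr hf] _].
case: (dot_eq0 (quots_perms4 hp2 hp3 hp4 hr) (hdot hr)) =>
  [[f0 _ _]|[g hg h]|[p [q [hm _]]]].
- by rewrite -hf in f0.
- by move: hf h; rewrite hg => -[->].
- by have := size_fixed_moved r; rewrite -hf hm.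
Qed.

Lemma degenerate_or_pairprod :
  degenerate \/ exists2 k, k \in [:: 1; 2; 3]%N & pairprod k = 0.
Proof.
have e0 := sign_neq0.
case/or4P: (triple_alternative hp2 hp3 hp4).
(* Two equal rows: no alternative of [dot_spec] holds for the identity. *)
- case/hasP=> r hr h0; have := size_fixed_moved r; rewrite (nilP h0) addn0.
  case: (dot_eq0 (quots_perms4 hp2 hp3 hp4 hr) (hdot hr)) =>
    [[/nilP-> _ _]|[g -> h]|[p [q [hm _]]]] //.
  by rewrite hm in h0.
- case/hasP=> r hr h0; right; have := size_fixed_moved r.
  case: (dot_eq0 (quots_perms4 hp2 hp3 hp4 hr) (hdot hr)) =>
    [[_ hk h] _|[g hg h]|[p [q [hm _]]]].
  + by exists (partner r).
  + by rewrite hg in h0.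
  + by rewrite (nilP h0) hm.
(* A constant column has [4 * a f = e], whereas the 3-cycle gives [a f = 0] or [2 * a f = e]; either
   way [e = 0]. *)
- case/hasP=> f /fixed_by_3cycle_eq0 /eqP + /hcol h4.
  rewrite mulf_eq0 => /orP[]/eqP h; case/eqP: e0; rewrite -h4.
    by rewrite h mulr0.
  transitivity (- (2 * (2 * a f - 4 * a f))); first by ring.
  by rewrite h4 h mulr0 oppr0.
- set s := fixed_by_3cycle _ => hs; left.
  have H f : f \in s -> a f * (2 * a f - e) = 0 := @fixed_by_3cycle_eq0 f.
  case: ha => he hsum hq; have hE := esym2_eq0.
  have D i j k l : perm_eq [:: i; j; k; l] (iota 0 4) ->
      j \in s -> k \in s -> l \in s -> degenerate.
    move=> hp /H hj /H hk /H hl.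
    have hsq (F : nat -> K) : F i + F j + F k + F l = F 0 + F 1 + F 2 + F 3.
      have : \sum_(x <- [:: i; j; k; l]) F x = \sum_(x <- iota 0 4) F x.
        exact: perm_big.
      by rewrite !big_cons !big_nil !addr0 !addrA.
    have hs1 : a i + a j + a k + a l = e by rewrite hsq.
    suff h2 : a i * a j + a i * a k + a i * a l + a j * a k + a j * a l
        + a k * a l = 0.
      have [h3 h4 h5] := three_half_or_zero hs1 h2 hj hk hl.
      exact: (@degenerate_intro i j k l).
    apply: (mulfI two_neq0); rewrite mulr0.
    transitivity ((a i + a j + a k + a l) ^+ 2
      - (a i ^+ 2 + a j ^+ 2 + a k ^+ 2 + a l ^+ 2)); first by ring.
    by rewrite hs1 (hsq (fun i => a i ^+ 2)) hq he subrr.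
  have hm f : f \in iota 0 4 ->
      (f \in s) = ([:: f] \in map fixed (quots p2 p3 p4)).
    by move=> hf; rewrite mem_filter hf andbT.
  have {}hs : (2 < count (mem s) (iota 0 4))%N.
    rewrite -size_filter; congr (2 < size _)%N: hs.
    by apply/eq_in_filter => f hf; first [exact: hm | exact/esym/hm].
  move: hs; rewrite /=.
  case h0: (_ \in s); case h1: (_ \in s); case h2: (_ \in s); case h3: (_ \in s) => // _.
  (* At most one label lies outside [s]; it is the first argument of [D]. *)
  all: first [exact: (D 0 1 2 3)%N | exact: (D 1 0 2 3)%N
    | exact: (D 2 0 1 3)%N | exact: (D 3 0 1 2)%N].
Qed.

Lemma degenerate_or_cyc4 : degenerate \/
  exists k, [/\ k \in [:: 1; 2; 3]%N, pairprod k = 0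
              & perm_eq [:: p2; p3; p4] (cyc4 k)].
Proof.
have [|[k hk h0]] := degenerate_or_pairprod; first by left.
have [|[h3 hp h2]] := degenerate_or_generic hk h0; first by left.
right; exists k; split=> //; apply: compatible_triple => //.
apply/allP=> r hr; apply: generic_compatible => //; last exact: hdot.
exact: quots_perms4 hr.
Qed.
End Triple.

Lemma dot_quot p q : p \in perms4 -> q \in perms4 ->
  \sum_(j < 4) a (nth 0 p j)%N * a (nth 0 q j)%N = dot (quot p q).
Proof.
rewrite !mem_permutations => hp hq.
have sp : size p = 4%N by rewrite (perm_size hp) size_iota.
have up : uniq p by rewrite (perm_uniq hp) iota_uniq.
rewrite /dot -(perm_big _ hp) /=.
rewrite (big_nth 0%N) sp big_mkord; apply: eq_bigr => j _.
have hj : (j < size p)%N by rewrite sp.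
have hj' : (nth 0 p j < 4)%N.
  by have := mem_nth 0 hj; rewrite (perm_mem hp) mem_iota.
by rewrite (nth_map 0%N) ?size_iota // nth_iota // index_uniq.
Qed.

Lemma degenerate_row k x p j : {in iota 0 4, forall j, j != k -> a j = x} ->
  p \in perms4 -> (j < 4)%N ->
  a (nth 0 p j)%N = if j == index k p then a k else x.
Proof.
rewrite mem_permutations => hx hp hj.
have sp : size p = 4%N by rewrite (perm_size hp) size_iota.
have up : uniq p by rewrite (perm_uniq hp) iota_uniq.
have hm : nth 0 p j \in p by rewrite mem_nth ?sp.
case: eqP => [jk|/eqP hjk].
  by rewrite jk nth_index // -index_mem -jk sp.
apply: hx; first by rewrite -(perm_mem hp).
by apply: contra hjk => /eqP <-; rewrite index_uniq ?sp.
Qed.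
End RowValues.

(** * Matrices whose rows rearrange the first row *)

Section Matrices.
Variable K : fieldType.
Implicit Types (A P : 'M[K]_4) (a : nat -> K).

Definition row_matrix a (ps : seq (seq nat)) : 'M[K]_4 :=
  \matrix_(i, j) a (nth 0 (nth [::] ps i) j)%N.

Definition cyc4_matrix k a : 'M[K]_4 := row_matrix a (iota 0 4 :: cyc4 k).

(** This is where [Pbar] comes from: a cyclic orbit is recovered only up to the order of its last
    three rows. *)
Lemma row_matrix_perm a c ps : perm_eq c ps -> size ps = 3 ->
  exists2 P, one_oplus_P3 P &
    row_matrix a (iota 0 4 :: c) = P *m row_matrix a (iota 0 4 :: ps).
Proof.
move=> hc hs; have [s hcs] := tuple_permP (t := Tuple (introT eqP hs)) hc.
exists (lift0_mx (perm_mx s)); first by exists s.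
rewrite lift0_mx_perm -row_permE; apply/matrixP=> i j; rewrite !mxE.
case: (unliftP ord0 i) => [i'|] ->; last by rewrite lift0_perm0.
rewrite lift0_perm_lift /= hcs.
by rewrite -[nth _ (tval _) _]tnth_nth tnth_mktuple (tnth_nth [::]).
Qed.

Lemma one_oplus_P3_trmxK P A : one_oplus_P3 P -> P^T *m (P *m A) = A.
Proof.
case=> s ->; rewrite lift0_mx_perm tr_perm_mx.
by rewrite mulmxA -perm_mxM mulVg perm_mx1 mul1mx.
Qed.

Lemma eq_cyc4_matrix k a b : {in iota 0 4, a =1 b} ->
  cyc4_matrix k a = cyc4_matrix k b.
Proof.
move=> h; apply/matrixP=> i j; rewrite !mxE; apply: h.
case: k => [|[|[|k]]]; case: i => [[|[|[|[|i]]]] hi] //;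
  by case: j => [[|[|[|[|j]]]] hj].
Qed.

(** * The block matrices and their conjugates as orbits of cyclic groups *)

Lemma Mmx_cyc4 (e x z : K) :
  Mmx e x z = cyc4_matrix 1 (nth 0 [:: x; - x; z; e - z]).
Proof.
apply/matrixP=> i j; rewrite !mxE.
case: (@splitP 2 2 i) => i' hi; rewrite !mxE; case: (@splitP 2 2 j) => j' hj; rewrite !mxE hi hj.
all: case: i' {hi} => [[|[|i']] hi] //; case: j' {hj} => [[|[|j']] hj] //=.
all: by rewrite opprK.
Qed.

Lemma Nmx_cyc4 (e x z : K) :
  Nmx e z x = cyc4_matrix 1 (nth 0 [:: z; e - z; x; - x]).
Proof.
apply/matrixP=> i j; rewrite !mxE.
case: (@splitP 2 2 i) => i' hi; rewrite !mxE; case: (@splitP 2 2 j) => j' hj; rewrite !mxE hi hj.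
all: case: i' {hi} => [[|[|i']] hi] //; case: j' {hj} => [[|[|j']] hj] //=.
all: by rewrite !big_ord_recl big_ord0 !mxE /= ?mul0r ?mul1r ?add0r ?addr0.
Qed.

Lemma tperm_conj (u v : 'I_4) A : perm_mx (tperm u v) *m A *m perm_mx (tperm u v)
  = \matrix_(i, j) A (tperm u v i) (tperm u v j).
Proof.
rewrite -row_permE -[X in _ *m perm_mx X]tpermV -col_permE.
by apply/matrixP=> i j; rewrite !mxE.
Qed.

(** Labels count from 0, so [P23] exchanges labels 1 and 2 and carries the pairing of 0 with 1 to
    that of 0 with 2. *)
Lemma P23_conj_cyc4 (x y z w : K) :
  P23 K *m cyc4_matrix 1 (nth 0 [:: x; y; z; w]) *m P23 K
  = cyc4_matrix 2 (nth 0 [:: x; z; y; w]).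
Proof.
rewrite tperm_conj; apply/matrixP=> i j; rewrite !mxE !permE /=.
by case: i => [[|[|[|[|i]]]] hi] //; case: j => [[|[|[|[|j]]]] hj].
Qed.

Lemma P24_conj_cyc4 (x y z w : K) :
  P24 K *m cyc4_matrix 1 (nth 0 [:: x; y; z; w]) *m P24 K
  = cyc4_matrix 3 (nth 0 [:: x; w; z; y]).
Proof.
rewrite tperm_conj; apply/matrixP=> i j; rewrite !mxE !permE /=.
by case: i => [[|[|[|[|i]]]] hi] //; case: j => [[|[|[|[|j]]]] hj].
Qed.

(** By simple transitivity each label occurs once in every row and column, so its positions form a
    permutation matrix. *)
Lemma cyc4_1_combination (x y z w : K) :
  cyc4_matrix 1 (nth 0 [:: x; y; z; w])
  = x *: P34 K + y *: P12 K + z *: P13_24 K + w *: P14_23 K.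
Proof.
apply/matrixP=> i j; rewrite !mxE !(permM, permE) /=.
by case: i => [[|[|[|[|i]]]] hi] //; case: j => [[|[|[|[|j]]]] hj];
  rewrite //= ?(mulr0, mulr1, add0r, addr0).
Qed.

Lemma cyc4_2_combination (x y z w : K) :
  cyc4_matrix 2 (nth 0 [:: x; y; z; w])
  = x *: P24 K + y *: P12_34 K + z *: P13 K + w *: P14_23 K.
Proof.
apply/matrixP=> i j; rewrite !mxE !(permM, permE) /=.
by case: i => [[|[|[|[|i]]]] hi] //; case: j => [[|[|[|[|j]]]] hj];
  rewrite //= ?(mulr0, mulr1, add0r, addr0).
Qed.

Lemma cyc4_3_combination (x y z w : K) :
  cyc4_matrix 3 (nth 0 [:: x; y; z; w])
  = x *: P23 K + y *: P12_34 K + z *: P13_24 K + w *: P14 K.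
Proof.
apply/matrixP=> i j; rewrite !mxE !(permM, permE) /=.
by case: i => [[|[|[|[|i]]]] hi] //; case: j => [[|[|[|[|j]]]] hj];
  rewrite //= ?(mulr0, mulr1, add0r, addr0).
Qed.

Lemma class_conj_combination (Q A : 'M[K]_4) : class_conj Q A -> exists P x y z w,
  [/\ one_oplus_P3 P,
      A = P *m (Q *m cyc4_matrix 1 (nth 0 [:: x; y; z; w]) *m Q),
      x + y + z + w = 1 \/ x + y + z + w = -1,
      x * y + z * w = 0 & x ^+ 2 + y ^+ 2 + z ^+ 2 + w ^+ 2 = 1].
Proof.
case=> P [e [x [z [hP he hxz h]]]]; exists P.
have he2 : e ^+ 2 = 1 by case: he => ->; rewrite ?sqrrN expr1n.
(* For the entries [x, - x, z, e - z] the sum of squares is the right-hand side here; the sum of the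
   two pair products is that of [h0]. *)
have hsq : 1 = e ^+ 2 + 2 * (x ^+ 2 + z ^+ 2 - e * z).
  by rewrite hxz mulr0 addr0 he2.
have h0 : 0 = - (x ^+ 2 + z ^+ 2 - e * z) by rewrite hxz oppr0.
case: h => ->.
  exists x, (- x), z, (e - z); rewrite Mmx_cyc4; split=> //.
  - by rewrite (_ : _ + (e - z) = e) //; ring.
  - by rewrite [RHS]h0; ring.
  - by rewrite [RHS]hsq; ring.
exists z, (e - z), x, (- x); rewrite Nmx_cyc4; split=> //.
- by rewrite (_ : _ + - x = e) //; ring.
- by rewrite [RHS]h0; ring.
- by rewrite [RHS]hsq; ring.
Qed.

Lemma classX_conj1 A : classX A <-> class_conj 1%:M A.
Proof.
by split=> -[P [e [x [z [hP he hxz h]]]]]; exists P, e, x, z; split=> //;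
  move: h; rewrite !mul1mx !mulmx1.
Qed.

Section OrthogonalRow.
Variables (e : K) (a : nat -> K).
Hypotheses (two_neq0 : (2%:R : K) != 0) (he : is_sign e) (ha : row_values e a).

(** The vanishing factor decides the type: [p + q = 0] gives [Mmx] with [x = p], [z = r], and
    [r + s = 0] gives [Nmx] with [x = r], [z = p]. *)
Lemma class_conj_cyc4 (Q P : 'M[K]_4) (p q r s : K) : one_oplus_P3 P ->
  p + q + r + s = e -> p ^+ 2 + q ^+ 2 + r ^+ 2 + s ^+ 2 = 1 ->
  (p + q) * (r + s) = 0 ->
  class_conj Q (P *m (Q *m cyc4_matrix 1 (nth 0 [:: p; q; r; s]) *m Q)).
Proof.
move=> hP hs hq /eqP; rewrite mulf_eq0 => /orP[]/eqP h.
  have hrs : r + s = e by rewrite -hs h add0r.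
  exists P, e, p, r; split=> //.
    by rewrite (pair_sqr two_neq0 ha h hrs hq) -hrs; ring.
  left; rewrite Mmx_cyc4 (addr0_eq h).
  by have -> : e - r = s by rewrite -hrs; ring.
have hpq : p + q = e by rewrite -hs -addrA h addr0.
have hq' : r ^+ 2 + s ^+ 2 + p ^+ 2 + q ^+ 2 = 1 by rewrite -hq; ring.
exists P, e, r, p; split=> //.
  by rewrite (pair_sqr two_neq0 ha h hpq hq') -hpq; ring.
right; rewrite Nmx_cyc4 (addr0_eq h).
by have -> : e - p = q by rewrite -hpq; ring.
Qed.

Lemma class_cyc4 P k : k \in [:: 1; 2; 3]%N -> pairprod a k = 0 ->
  one_oplus_P3 P -> let A := P *m cyc4_matrix k a in
  classX A \/ classY A \/ classZ A.
Proof.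
have [_ hs hq] := ha.
rewrite (@eq_cyc4_matrix k a (nth 0 [:: a 0; a 1; a 2; a 3]%N)); last first.
  by move=> j; rewrite !inE => /or4P[]/eqP->.
rewrite !inE => /or3P[]/eqP-> h hP /=.
- left; apply/classX_conj1.
  have := class_conj_cyc4 1%:M hP hs hq h.
  by rewrite mul1mx mulmx1.
- right; left; rewrite -P23_conj_cyc4; apply: class_conj_cyc4 => //.
    by rewrite -hs; ring.
  by rewrite -hq; ring.
- right; right; rewrite -P24_conj_cyc4; apply: class_conj_cyc4 => //.
  + by rewrite -hs; ring.
  + by rewrite -hq; ring.
  + by rewrite (addrC (a 2%N)).
Qed.
End OrthogonalRow.

(** * From an orthogonal permutative matrix to its labelled rows and its class *)

Lemma row_labels A (i k : 'I_4) : permutative A -> exists2 p, p \in perms4 &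
  forall j : 'I_4, A i j = A k (inord (nth 0%N p j)).
Proof.
move=> /(_ i k)[s hs]; exists [seq val (s j) | j <- enum 'I_4].
  rewrite mem_permutations -val_enum_ord (map_comp val s); apply: perm_map.
  rewrite uniq_perm ?enum_uniq ?(map_inj_uniq (@perm_inj _ s)) ?enum_uniq //.
  by move=> j; rewrite mem_enum -[j](permKV s) map_f ?mem_enum.
move=> j; rewrite (nth_map j) ?size_enum_ord // nth_ord_enum inord_val.
by have /rowP/(_ j) := hs; rewrite !mxE.
Qed.

Lemma orthogonal_permutative_class A : (2%:R : K) != 0 ->
  orthogonal_permutative A -> classX A \/ classY A \/ classZ A.
Proof.
move=> two_neq0 [hperm hA].
have hAT : A *m A^T = 1%:M by exact: mulmx1C.
have rowE i k : \sum_j A i j * A k j = (i == k)%:R.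
  have /matrixP/(_ i k) := hAT; rewrite !mxE => <-.
  by apply: eq_bigr => j _; rewrite mxE.
have colE i k : \sum_j A j i * A j k = (i == k)%:R.
  have /matrixP/(_ i k) := hA; rewrite !mxE => <-.
  by apply: eq_bigr => j _; rewrite mxE.
pose a j := A i1 (inord j); pose e := \sum_j A i1 j.
have rowp i : exists2 p, p \in perms4 & forall j : 'I_4, A i j = a (nth 0%N p j).
  exact: (row_labels i i1 hperm).
have sum_row i : \sum_j A i j = e.
  have [s hs] := hperm i i1.
  rewrite /e [RHS](reindex_inj (@perm_inj _ s)); apply: eq_bigr => j _.
  by have /rowP/(_ j) := hs; rewrite !mxE.
(* Column [j] is paired with the sum of all columns, whose entries are the row sums [e]; column
   orthonormality leaves 1. *)
have sum_col j : e * \sum_i A i j = 1.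
  transitivity (\sum_i \sum_k A i k * A i j).
    rewrite mulr_sumr; apply: eq_bigr => i _.
    by rewrite -(sum_row i) mulr_suml.
  rewrite exchange_big /=; under eq_bigr => k _ do rewrite colE.
  rewrite (bigD1 j) //= eqxx big1 ?addr0 // => k /negPf->.
  by [].
(* Summing over the four columns gives [4 = e * (4 * e)]. *)
have he2 : e ^+ 2 = 1.
  have h : e * \sum_i \sum_j A i j = 4.
    rewrite exchange_big mulr_sumr; under eq_bigr do rewrite sum_col.
    by rewrite sumr_const card_ord.
  apply: (mulfI two_neq0); apply: (mulfI two_neq0).
  transitivity (4 : K); last by ring.
  rewrite -h; under eq_bigr do rewrite sum_row.
  by rewrite sumr_const card_ord -mulr_natr; ring.
have he : is_sign e.
  by move/eqP: he2; rewrite sqrf_eq1 => /orP[]/eqP; [left|right].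
have {}sum_col j : \sum_i A i j = e.
  by rewrite -[LHS]mul1r -he2 expr2 -mulrA sum_col mulr1.
have sum4 (F : 'I_4 -> K) : \sum_j F j = F i1 + F i2 + F i3 + F i4.
  rewrite !big_ord_recl big_ord0 addr0 !addrA.
  by congr (F _ + F _ + F _ + F _); exact: val_inj.
have inordE : (inord 0 = i1) * (inord 1 = i2) * (inord 2 = i3) * (inord 3 = i4).
  by do ![split]; apply: val_inj; rewrite /= inordK.
have ha : row_values e a.
  split=> //; first by rewrite /a !inordE /e sum4.
  transitivity (\sum_j A i1 j * A i1 j); last by rewrite rowE eqxx.
  by rewrite sum4 /a !inordE !expr2.
have [p2 hp2 h2] := rowp i2; have [p3 hp3 h3] := rowp i3.
have [p4 hp4 h4] := rowp i4.
have h1 (j : 'I_4) : A i1 j = a (nth 0 (iota 0 4) j)%N.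
  by rewrite nth_iota // /a inord_val.
have dotE i k p q : p \in perms4 -> q \in perms4 ->
    (forall j : 'I_4, A i j = a (nth 0 p j)%N) ->
    (forall j : 'I_4, A k j = a (nth 0 q j)%N) -> dot a (quot p q) = (i == k)%:R.
  move=> hp hq hi hk; rewrite -dot_quot // -rowE.
  by apply: eq_bigr => j _; rewrite hi hk.
have hdot : {in quots p2 p3 p4, forall r, dot a r = 0}.
  have hp1 : iota 0 4 \in perms4 by rewrite mem_permutations.
  have := dotE _ _ _ _ hp1 hp2 h1 h2; have := dotE _ _ _ _ hp1 hp3 h1 h3.
  have := dotE _ _ _ _ hp1 hp4 h1 h4; rewrite !quot_iota // => d14 d13 d12.
  have d23 := dotE _ _ _ _ hp2 hp3 h2 h3; have d24 := dotE _ _ _ _ hp2 hp4 h2 h4.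
  have d34 := dotE _ _ _ _ hp3 hp4 h3 h4.
  by move=> r; rewrite !inE => /orP[|/orP[|/or4P[]]] /eqP->.
have hcol f : all (fun p => nth 0 p f == f)%N [:: p2; p3; p4] -> 4 * a f = e.
  case/and4P=> /eqP f2 /eqP f3 /eqP f4 _.
  (* Beyond the length of a list [nth] returns 0, which cannot equal such an [f]. *)
  have hf : (f < 4)%N.
    rewrite ltnNge; apply/negP=> hf.
    have := hp2; rewrite mem_permutations => /perm_size sp2.
    by move: f2; rewrite nth_default ?sp2 // => f0; rewrite -f0 in hf.
  rewrite -(sum_col (inord f)) sum4 h2 h3 h4 inordK // f2 f3 f4.
  by rewrite /a; ring.
have AE : A = row_matrix a [:: iota 0 4; p2; p3; p4].
  apply/matrixP=> i j; rewrite mxE.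
  case: i => [[|[|[|[|i]]]] hi] //=; rewrite -?h1 -?h2 -?h3 -?h4;
    by congr (A _ _); exact: val_inj.
case: (degenerate_or_cyc4 two_neq0 ha hp2 hp3 hp4 hdot hcol); last first.
  case=> k [hk h0 hc].
  have [|P hP EP] := row_matrix_perm a hc; first by case: (k) => [|[|[|?]]].
  rewrite AE EP; exact: (class_cyc4 two_neq0 he ha).
move=> hdeg; have [k [x [hk hx _]]] := hdeg.
(* In a degenerate row the position of the exceptional label [k] determines all entries, so two rows
   sharing that position would be equal and have inner product 1. *)
have index_neq p q : p \in perms4 -> q \in perms4 -> dot a (quot p q) = 0 ->
    index k p != index k q.
  move=> hp hq hpq; apply/eqP=> hi; case/eqP: (oner_neq0 K).
  have hqq : dot a (quot q q) = 1.
    have [_ _ <-] := ha; rewrite quot_self // /dot !big_cons big_nil addr0 /=.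
    by rewrite !expr2 !addrA.
  rewrite -hqq -hpq -!dot_quot //; apply: eq_bigr => j _.
  by rewrite !(degenerate_row hx) // hi.
have huniq : uniq [seq index k p | p <- [:: iota 0 4; p2; p3; p4]].
  have hp1 : iota 0 4 \in perms4 by rewrite mem_permutations.
  have n1 p : p \in perms4 -> dot a p = 0 -> index k (iota 0 4) != index k p.
    by move=> hp h; apply: index_neq; rewrite ?quot_iota.
  rewrite [map _ _]/= /uniq !inE !negb_or; apply/and4P; split=> //.
  - by apply/and3P; split; apply: n1 => //; apply: hdot; rewrite !inE eqxx ?orbT.
  - by apply/andP; split; apply: index_neq => //; apply: hdot; rewrite !inE eqxx ?orbT.
  - by apply: index_neq => //; apply: hdot; rewrite !inE eqxx ?orbT.
(* Any of the three cyclic groups would do, since every [pairprod] vanishes on a degenerate row. *)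
have [c hc hcE] := uniq_index_cyc4 hk hp2 hp3 hp4 huniq.
have [P hP EP] := row_matrix_perm a hc erefl.
rewrite AE (_ : row_matrix _ _ = row_matrix a (iota 0 4 :: c)).
  by rewrite EP; apply: (class_cyc4 two_neq0 he ha) => //; exact: degenerate_pairprod.
have hcp : {subset c <= perms4}.
  by move=> p; rewrite (perm_mem hc) !inE => /or3P[]/eqP->; vm_compute.
case: c hc hcE hcp {EP} => [|c2 [|c3 [|c4 []]]] // hc [e2 e3 e4] hcp.
apply/matrixP=> i j; rewrite !mxE.
have hr p q : p \in perms4 -> q \in perms4 -> index k p = index k q ->
    a (nth 0 p j)%N = a (nth 0 q j)%N.
  by move=> hp hq hi; rewrite !(degenerate_row hx) // hi.
case: i => [[|[|[|[|i]]]] hi] //=; apply: hr => //; apply: hcp.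
all: by rewrite !inE eqxx ?orbT.
Qed.
End Matrices.

Theorem mainTheorem3 (R : realType) (A : 'M[R[i]]_4)
    (hA : orthogonal_permutative A) :
  [/\ classX A \/ classY A \/ classZ A,
      classX A -> exists (Pbar : 'M[R[i]]_4) (x y z w : R[i]),
        [/\ one_oplus_P3 Pbar,
            Pbar^T *m A = x *: P34 R[i] + y *: P12 R[i]
                          + z *: P13_24 R[i] + w *: P14_23 R[i],
            x + y + z + w = 1 \/ x + y + z + w = -1,
            x * y + z * w = 0 &
            x ^+ 2 + y ^+ 2 + z ^+ 2 + w ^+ 2 = 1],
      classY A -> exists (Pbar : 'M[R[i]]_4) (x y z w : R[i]),
        [/\ one_oplus_P3 Pbar,
            Pbar^T *m A = x *: P24 R[i] + y *: P12_34 R[i]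
                          + z *: P13 R[i] + w *: P14_23 R[i],
            x + y + z + w = 1 \/ x + y + z + w = -1,
            x * z + y * w = 0 &
            x ^+ 2 + y ^+ 2 + z ^+ 2 + w ^+ 2 = 1] &
      classZ A -> exists (Pbar : 'M[R[i]]_4) (x y z w : R[i]),
        [/\ one_oplus_P3 Pbar,
            Pbar^T *m A = x *: P23 R[i] + y *: P12_34 R[i]
                          + z *: P13_24 R[i] + w *: P14 R[i],
            x + y + z + w = 1 \/ x + y + z + w = -1,
            x * w + y * z = 0 &
            x ^+ 2 + y ^+ 2 + z ^+ 2 + w ^+ 2 = 1]].
Proof.
split.
- by apply: orthogonal_permutative_class hA; rewrite Num.Theory.pnatr_eq0.
- move=> /classX_conj1/class_conj_combination[P [x [y [z [w [hP -> hs h0 hq]]]]]].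
  exists P, x, y, z, w; split=> //.
  by rewrite one_oplus_P3_trmxK // mul1mx mulmx1 cyc4_1_combination.
- move=> /class_conj_combination[P [x [y [z [w [hP -> hs h0 hq]]]]]].
  (* Conjugation by [P23] exchanges the two middle coefficients; in the last case [P24] exchanges
     the second and the fourth. *)
  exists P, x, z, y, w; split=> //; last by rewrite -hq; ring.
    by rewrite one_oplus_P3_trmxK // P23_conj_cyc4 cyc4_2_combination.
  by rewrite [x + z + y](addrAC x).
- move=> /class_conj_combination[P [x [y [z [w [hP -> hs h0 hq]]]]]].
  exists P, x, w, z, y; split=> //.
  + by rewrite one_oplus_P3_trmxK // P24_conj_cyc4 cyc4_3_combination.
  + by rewrite (_ : _ + y = x + y + z + w) //; ring.
  + by rewrite -h0; ring.
  + by rewrite -hq; ring.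
Qed.
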